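(* Let $A,B$ be $m\times n$ sign-restricted matrices with the same row sum vector $R$ and the same column sum vector $S$. Then: (i) there exist sign-restricted matrices $A^{(1)},\ldots,A^{(k)}$ with $A^{(1)}=A$ and $A^{(k)}\in\mathcal{A}(R,S)$, such that $A^{(i+1)}$ is obtained from $A^{(i)}$ by an interchange for $1\le i<k$; (ii) there exist sign-restricted matrices $A^{(1)},\ldots,A^{(p)}$ with $A^{(1)}=A$ and $A^{(p)}=B$, such that $A^{(i+1)}$ is obtained from $A^{(i)}$ by an interchange for $1\le i<p$.
   Context: A sign-restricted matrix (SRM) is an $m\times n$ matrix $A=[a_{ij}]$ with entries in $\{0,1,-1\}$ such that every partial column sum $\sum_{k=1}^{i} a_{kj}$ equals $0$ or $1$, and every partial row sum $\sum_{l=1}^{j} a_{il}$ is nonnegative. An interchange applied to a matrix consists of adding or subtracting $E=\begin{bmatrix}1&-1\\-1&1\end{bmatrix}$ to some $2\times 2$ submatrix (rows $i<i'$, columns $j<j'$, not necessarily consecutive). $\mathcal{A}(R,S)$ denotes the set of $(0,1)$-matrices with row sum vector $R$ and column sum vector $S$. *)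

(* Defs.v *)
From mathcomp Require Import all_boot all_order all_algebra.
Set Implicit Arguments.
Unset Strict Implicit.
Unset Printing Implicit Defensive.
Import GRing.Theory.
Local Open Scope ring_scope.

Definition partial_col_sum m n (A : 'M[int]_(m, n)) (i : 'I_m) (j : 'I_n) : int :=
  \sum_(k < m | (k <= i)%N) A k j.

Definition partial_row_sum m n (A : 'M[int]_(m, n)) (i : 'I_m) (j : 'I_n) : int :=
  \sum_(l < n | (l <= j)%N) A i l.

Definition sign_restricted m n (A : 'M[int]_(m, n)) : bool :=
  [&& [forall i, forall j, A i j \in [:: 0; 1; -1]],
      [forall i, forall j, partial_col_sum A i j \in [:: 0; 1]]
    & [forall i, forall j, 0 <= partial_row_sum A i j]].

Definition row_sums m n (A : 'M[int]_(m, n)) : 'rV[int]_m :=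
  \row_(i < m) \sum_(j < n) A i j.

Definition col_sums m n (A : 'M[int]_(m, n)) : 'rV[int]_n :=
  \row_(j < n) \sum_(i < m) A i j.

Definition zero_one_class m n (R : 'rV[int]_m) (S : 'rV[int]_n) :
    pred 'M[int]_(m, n) :=
  [pred A : 'M[int]_(m, n) | [&& [forall i, forall j, A i j \in [:: 0; 1]],
                row_sums A == R & col_sums A == S]].

(* The matrix [1 -1; -1 1] placed on rows i, i' and columns j, j', and zero
   elsewhere (for i <> i' and j <> j'). *)
Definition interchange_mx m n (i i' : 'I_m) (j j' : 'I_n) : 'M[int]_(m, n) :=
  delta_mx i j - delta_mx i j' - delta_mx i' j + delta_mx i' j'.

Definition is_interchange m n : rel 'M[int]_(m, n) := fun A B =>
  [exists i : 'I_m, exists i' : 'I_m, exists j : 'I_n, exists j' : 'I_n,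
    [&& (i < i')%N, (j < j')%N
      & (B == A + interchange_mx i i' j j')
        || (B == A - interchange_mx i i' j j')]].

(* Main.v *)
Require Import Defs.
From mathcomp Require Import all_boot all_order all_algebra.
From mathcomp Require Import zify.
Set Implicit Arguments.
Unset Strict Implicit.
Unset Printing Implicit Defensive.
Import Order.TTheory GRing.Theory Num.Theory.
Local Open Scope ring_scope.

(** Row [k] of the matrix of partial column sums of a sign-restricted matrix is
    the indicator of a set [C_k], and the conditions say that every prefix of
    the columns contains at least as many elements of [C_(k+1)] as of [C_k].
    Suppose [C_k] does not consist of the first elements of [C_(k+1)].  Let [j]
    be the first column where they differ; then [j] lies in [C_(k+1)] only, and
    replacing by [j] the next element [j' > j] of [C_k] preserves all
    conditions.  This is an interchange on two consecutive rows, and it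
    decreases the sum of all elements of all the [C_k].  So repeated moves stop,
    at a matrix where each [C_k] is an initial segment of [C_(k+1)].  That
    matrix has entries in {0, 1} and, as [C_m] and the cardinals of the [C_k]
    are given by the column and row sums, it depends only on these sums.
    Interchanges being reversible, both claims follow. *)

(** * Prefix sums of vectors *)

Definition psum {n} (x : 'I_n -> int) (k : nat) : int := \sum_(l < n | (l < k)%N) x l.

Lemma psumS n (x : 'I_n -> int) (j : 'I_n) : psum x j.+1 = psum x j + x j.
Proof.
rewrite /psum (bigD1 j) //= addrC; congr (_ + _).
by apply: eq_bigl => l; rewrite ltnS ltn_neqAle andbC.
Qed.

Lemma eq_psum n (x y : 'I_n -> int) k :
  (forall l : 'I_n, (l < k)%N -> x l = y l) -> psum x k = psum y k.
Proof. by move=> e; apply: eq_bigr. Qed.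

Lemma psum_stable n (x : 'I_n -> int) j k : (j <= k)%N ->
  (forall l : 'I_n, (j <= l < k)%N -> x l = 0) -> psum x k = psum x j.
Proof.
move=> jk x0; rewrite /psum big_mkcond [RHS]big_mkcond; apply: eq_bigr => l _.
case: (ltnP l j) => lj; first by rewrite (leq_trans lj jk).
by case: ifP => // lk; rewrite x0 // lj.
Qed.

Lemma psum_mono n (x : 'I_n -> int) j k : (j <= k)%N ->
  (forall l, 0 <= x l) -> psum x j <= psum x k.
Proof.
move=> jk x0; rewrite /psum big_mkcond [leRHS]big_mkcond; apply: ler_sum => l _.
case: (ltnP l j) => lj; first by rewrite (leq_trans lj jk).
by case: ifP.
Qed.

Lemma psumD n (x y : 'I_n -> int) k :
  psum (fun l => x l + y l) k = psum x k + psum y k.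
Proof. exact: big_split. Qed.

Lemma psumB n (x y : 'I_n -> int) k :
  psum (fun l => x l - y l) k = psum x k - psum y k.
Proof. by rewrite /psum sumrB. Qed.

Lemma psum_pred1 n (j : 'I_n) k : psum (fun l => (l == j)%:R) k = (j < k)%N%:R.
Proof.
rewrite /psum big_mkcond (bigD1 j) //= eqxx big1 ?addr0 => [|l /negbTE->].
  by case: ifP.
by rewrite if_same.
Qed.

Lemma psum_full n (x : 'I_n -> int) : psum x n = \sum_l x l.
Proof. by apply: eq_bigl => l; rewrite ltn_ord. Qed.

(** Added to the indicator of a set containing [j'] but not [j], it replaces the element [j'] by
    [j]. *)
Definition move_left n (j j' l : 'I_n) : int := (l == j)%:R - (l == j')%:R.

Lemma psum_move_left n (j j' : 'I_n) k :
  psum (move_left j j') k = (j < k)%N%:R - (j' < k)%N%:R.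
Proof. by rewrite psumB !psum_pred1. Qed.

(** * Comparing two indicator vectors *)

Definition dominated {n} (x y : 'I_n -> int) : Prop :=
  forall j : 'I_n, psum x j.+1 <= psum y j.+1.

Definition initial_part {n} (x y : 'I_n -> int) : Prop :=
  exists a : nat, forall l : 'I_n, x l = if (l < a)%N then y l else 0.

Lemma dominated_move n (x y : 'I_n -> int) :
    (forall l, x l \in [:: 0; 1]) -> (forall l, y l \in [:: 0; 1]) ->
    dominated x y ->
  initial_part x y \/
  exists j j' : 'I_n, [/\ (j < j')%N, x j = 0, x j' = 1 &
    dominated (fun l => x l + move_left j j' l) y].
Proof.
move=> x01 y01 xy.
case: (pickP (fun j => x j != y j)) => [j0 Dj0|eqxy]; last first.
  by left; exists n => l; rewrite ltn_ord; apply/eqP; rewrite -[_ == _]negbK eqxy.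
case: (arg_minnP (P := fun j => x j != y j) (@nat_of_ord n) Dj0) => j Dj minj.
have eqlt (l : 'I_n) : (l < j)%N -> x l = y l.
  by move=> lj; apply: contraTeq lj => /minj; rewrite -leqNgt.
have eqj : psum x j = psum y j by apply: eq_psum.
(* The prefix sums before [j] agree, so domination at [j] rules out [x j = 1] with [y j = 0]. *)
have [xj yj] : x j = 0 /\ y j = 1.
  move: (xy j) Dj; rewrite !psumS eqj lerD2l.
  by move: (x01 j) (y01 j); rewrite !inE => /orP[]/eqP-> /orP[]/eqP->.
(* If [x] has no element after [j], it is [y] cut off at [j]. *)
case: (pickP (fun l : 'I_n => (j < l)%N && (x l != 0))) => [l0 Pl0|none]; last first.
  left; exists (nat_of_ord j) => l; case: ltngtP => [/eqlt//|jl|/val_inj->//].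
  by move: (none l); rewrite jl /= => /negbT; rewrite negbK => /eqP.
right; case: (arg_minnP (P := fun l : 'I_n => (j < l)%N && (x l != 0))
  (@nat_of_ord n) Pl0) => j' /andP[jj' xj'] minj'.
exists j, j'; split=> //.
  by move: (x01 j') xj'; rewrite !inE => /orP[]/eqP->.
(* Only prefixes whose last column [l] satisfies [j <= l < j'] gain 1. There [x] still has its sum
   from before [j], while [y] has gained 1 at [j]. *)
move=> l; rewrite psumD psum_move_left !ltnS.
have := xy l; case: (leqP j l) => [jl|lj]; last first.
  by rewrite leqNgt (ltn_trans lj jj') /= subrr addr0.
case: (leqP j' l) => [|lj'] _; first by rewrite subrr addr0.
rewrite subr0 (@psum_stable _ _ j l.+1) ?leqW //; last first.
  move=> i /andP[ji il]; case: (ltngtP j i) ji => // [{}ji _|/val_inj<- //].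
  apply/eqP/negbNE/negP => xi; have := minj' i; rewrite ji xi => /(_ isT).
  by rewrite leqNgt (leq_trans il lj').
have y0 i : 0 <= y i by move: (y01 i); rewrite !inE => /orP[]/eqP->.
by apply: le_trans (@psum_mono _ y j.+1 l.+1 _ y0); rewrite // psumS eqj yj.
Qed.

(** Two cuts of a nonnegative [y] are nested, so their difference has constant sign and vanishes
    once its total is 0. *)
Lemma initial_part_inj n (x x' y : 'I_n -> int) :
    (forall l, 0 <= y l) -> initial_part x y -> initial_part x' y ->
  \sum_l x l = \sum_l x' l -> x =1 x'.
Proof.
move=> y0 [a xE] [a' x'E]; wlog aa' : a a' x x' xE x'E / (a <= a')%N.
  move=> W; case/orP: (leq_total a a') => h e; first exact: W e.
  by apply: fsym; apply: W (esym e).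
move=> e; have le l : 0 <= x' l - x l.
  rewrite xE x'E; case: (ltnP l a) => la; first by rewrite (leq_trans la aa') subrr.
  by rewrite subr0; case: ifP.
have /eqP : \sum_l (x' l - x l) = 0 by rewrite sumrB e subrr.
rewrite psumr_eq0 // => /allP z l; have := z l (mem_index_enum l).
by rewrite /= subr_eq0 => /eqP.
Qed.

Lemma sum_move_left n (j j' : 'I_n) : \sum_l move_left j j' l = 0.
Proof. by rewrite -psum_full psum_move_left !ltn_ord subrr. Qed.

(** * Partial column sums and the effect of an interchange *)

Definition csum {m n} (A : 'M[int]_(m, n)) (k : nat) (j : 'I_n) : int :=
  psum (A^~ j) k.

Section ColumnPartialSums.
Context {m n : nat}.
Implicit Types A B : 'M[int]_(m, n).

Lemma csum0 A j : csum A 0 j = 0.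
Proof. by rewrite /csum /psum big1. Qed.

Lemma csumS A (i : 'I_m) j : csum A i.+1 j = csum A i j + A i j.
Proof. exact: psumS. Qed.

Lemma csum_full A j : csum A m j = col_sums A 0 j.
Proof. by rewrite /csum psum_full mxE. Qed.

Lemma sum_csum A k : \sum_j csum A k j = psum (fun i => row_sums A 0 i) k.
Proof. by rewrite /csum /psum exchange_big; apply: eq_bigr => i _; rewrite mxE. Qed.

Lemma csum_inj A B :
  (forall k, (k <= m)%N -> csum A k =1 csum B k) -> A = B.
Proof.
move=> e; apply/matrixP => i j; have := e i.+1 (ltn_ord i) j.
by rewrite !csumS e ?(ltnW (ltn_ord i)) // => /addrI.
Qed.

Lemma partial_row_sumE A i j :
  partial_row_sum A i j = psum (csum A i.+1) j.+1 - psum (csum A i) j.+1.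
Proof.
rewrite -psumB; apply: eq_bigr => l _.
by rewrite csumS addrC addKr.
Qed.

Lemma sign_restrictedP A :
  sign_restricted A <->
  (forall k j, (k <= m)%N -> csum A k j \in [:: 0; 1]) /\
  (forall k, (k < m)%N -> dominated (csum A k) (csum A k.+1)).
Proof.
split=> [/and3P[_ /forallP col /forallP row]|[col row]].
  split=> [[|k] j km|k km j]; first by rewrite csum0 inE.
    exact: (forallP (col (Ordinal km)) j).
  have := forallP (row (Ordinal km)) j.
  by rewrite partial_row_sumE subr_ge0.
apply/and3P; split; apply/forallP => i; apply/forallP => j.
(* An entry is the difference of two consecutive partial column sums, both 0 or 1. *)
- have := csumS A i j; move: (col i.+1 j (ltn_ord i)) (col i j (ltnW (ltn_ord i))).
  by rewrite !inE => /orP[]/eqP-> /orP[]/eqP-> ?; lia.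
- exact: (col i.+1 j (ltn_ord i)).
- by rewrite partial_row_sumE subr_ge0; apply: row.
Qed.

(** The changes in the adjacent rows [i] and [i'] cancel, except in the partial sum that stops
    between them. *)
Lemma csum_interchange A (i i' : 'I_m) (j j' : 'I_n) k l : i' = i.+1 :> nat ->
  csum (A + interchange_mx i i' j j') k l =
  csum A k l + (k == i.+1)%:R * move_left j j' l.
Proof.
move=> ii'.
(* The interchange matrix is an outer product of two [move_left] vectors. *)
transitivity (psum (fun r => A r l + ((r == i)%:R - (r == i')%:R) * move_left j j' l) k).
  apply: eq_psum => r _; rewrite !mxE /move_left.
  by case: (r == i); case: (r == i'); case: (l == j); case: (l == j').
rewrite psumD; congr (_ + _).
rewrite /psum -mulr_suml; congr (_ * _).
have := psum_move_left i i' k; rewrite /psum => ->.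
by rewrite ii'; case: (ltngtP k i.+1) => h; rewrite ?h; lia.
Qed.

Lemma row_sums_interchange A (i i' : 'I_m) (j j' : 'I_n) :
  row_sums (A + interchange_mx i i' j j') = row_sums A.
Proof.
apply/rowP => r; rewrite !mxE.
transitivity (\sum_l (A r l + ((r == i)%:R - (r == i')%:R) * move_left j j' l)).
  apply: eq_bigr => l _; rewrite !mxE /move_left.
  by case: (r == i); case: (r == i'); case: (l == j); case: (l == j').
by rewrite big_split -mulr_sumr sum_move_left mulr0 /= addr0.
Qed.

Lemma col_sums_interchange A (i i' : 'I_m) (j j' : 'I_n) :
  col_sums (A + interchange_mx i i' j j') = col_sums A.
Proof.
apply/rowP => l; rewrite !mxE.
transitivity (\sum_r (A r l + move_left i i' r * move_left j j' l)).
  apply: eq_bigr => r _; rewrite !mxE /move_left.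
  by case: (r == i); case: (r == i'); case: (l == j); case: (l == j').
by rewrite big_split -mulr_suml sum_move_left mul0r /= addr0.
Qed.

Lemma is_interchange_sym : symmetric (@is_interchange m n).
Proof.
suff imp A B : is_interchange A B -> is_interchange B A.
  by move=> A B; apply/idP/idP; apply: imp.
do 4![case/existsP => ?]; case/and3P => ii' jj' E.
do 4![apply/existsP; eexists]; apply/and3P; split; [exact: ii'|exact: jj'|].
by case/orP: E => /eqP->; rewrite ?addrK ?subrK eqxx ?orbT.
Qed.

(** * Chains of interchanges *)

Definition srm_linked A B : Prop :=
  exists s : seq 'M[int]_(m, n),
     [/\ all (@sign_restricted m n) (A :: s),
         path (@is_interchange m n) A s
       & last A s = B].

Lemma srm_linked_refl A : sign_restricted A -> srm_linked A A.
Proof. by move=> srA; exists [::]; rewrite /= srA. Qed.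

Lemma srm_linked_step A B :
  sign_restricted A -> sign_restricted B -> is_interchange A B -> srm_linked A B.
Proof. by move=> srA srB AB; exists [:: B]; rewrite /= srA srB AB. Qed.

Lemma srm_linked_trans A B C : srm_linked A B -> srm_linked B C -> srm_linked A C.
Proof.
case=> s [/= /andP[srA srs] ps <-] [t [/= /andP[_ srt] pt <-]].
by exists (s ++ t); rewrite /= srA all_cat srs srt cat_path ps pt last_cat.
Qed.

Lemma srm_linked_sym A B : srm_linked A B -> srm_linked B A.
Proof.
case=> s; elim: s A => [|C s IH] A [/= /andP[srA]].
  by move=> _ _ <-; apply: srm_linked_refl.
move=> srs /andP[AC ps] lastB; have CB : srm_linked B C by apply: IH.
apply: srm_linked_trans CB _; case/andP: srs => srC _.
by apply: srm_linked_step; rewrite // is_interchange_sym.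
Qed.

(** * The normal form *)

Definition packed A : Prop :=
  forall k, (k < m)%N -> initial_part (csum A k) (csum A k.+1).

(** Before the cut, rows [i] and [i.+1] of [csum] agree and the entry is 0; from the cut on, row [i]
    is 0 and the entry is that of row [i.+1]. *)
Lemma packed_zero_one A : sign_restricted A -> packed A ->
  A \in zero_one_class (row_sums A) (col_sums A).
Proof.
case/sign_restrictedP => col _ pA; rewrite inE !eqxx !andbT.
apply/forallP => i; apply/forallP => j.
have [a E] := pA i (ltn_ord i); have := csumS A i j; rewrite {}E.
move: (col i.+1 j (ltn_ord i)); case: ifP => _.
  by rewrite -[LHS in LHS = _ -> _]addr0 => _ /addrI <-.
by rewrite add0r => ? <-.
Qed.

Lemma packed_inj A B : sign_restricted A -> packed A -> packed B ->
  row_sums A = row_sums B -> col_sums A = col_sums B -> A = B.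
Proof.
case/sign_restrictedP => col _ pA pB eR eS; apply: csum_inj => k km.
(* Downward induction from row [m] of [csum], which holds the column sums. The total of each earlier
   row, fixed by the row sums, determines where it cuts the next one. *)
rewrite -(subKn km); elim: (m - k)%N => [|d IH] j.
  by rewrite subn0 !csum_full eS.
(* For [d >= m] both truncated differences are 0. *)
case: (leqP m d) => [md|dm]; first
  by have -> : (m - d.+1 = m - d)%N by lia.
have E : (m - d = (m - d.+1).+1)%N by lia.
have km' : (m - d.+1 < m)%N by lia.
move: IH; rewrite {}E => IH; have pA' := pA _ km'; have [b EB] := pB _ km'.
apply: (@initial_part_inj _ _ _ (csum A (m - d.+1).+1)) => // [l||].
- by have := col _ l km'; rewrite !inE => /orP[]/eqP->.
- by exists b => l; rewrite EB IH.
- by rewrite !sum_csum eR.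
Qed.

(** * Termination of the moves *)

Definition weight A : int := \sum_(k < m.+1) \sum_j csum A k j *+ j.

Lemma weight_ge0 A : sign_restricted A -> 0 <= weight A.
Proof.
case/sign_restrictedP => col _; apply: sumr_ge0 => k _; apply: sumr_ge0 => j _.
by rewrite mulrn_wge0 //; have := col k j (leq_ord k); rewrite !inE => /orP[]/eqP->.
Qed.

Lemma weight_interchange A (i i' : 'I_m) (j j' : 'I_n) :
  i' = i.+1 :> nat ->
  weight (A + interchange_mx i i' j j') = weight A + (j%:Z - j'%:Z).
Proof.
move=> ii'; pose D : int := \sum_l move_left j j' l *+ l.
have DE : D = j%:Z - j'%:Z.
  rewrite /D; under eq_bigr do rewrite mulrnBl.
  rewrite sumrB (bigD1 j) //= big1 => [|l /negbTE->]; last by rewrite mul0rn.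
  rewrite (bigD1 j') //= [X in _ - (_ + X)]big1 => [|l /negbTE->]; last by rewrite mul0rn.
  by rewrite !eqxx !addr0 !natz.
rewrite -DE /weight; under eq_bigr => k _.
  under eq_bigr do rewrite csum_interchange // mulrnDl -mulrnAr.
  rewrite big_split -mulr_sumr /=; over.
rewrite big_split -mulr_suml /=; congr (_ + _).
(* Row [i.+1] of [csum] is the only one that changes. *)
have im : (i.+1 < m.+1)%N by rewrite ltnS.
rewrite (bigD1 (Ordinal im)) //= eqxx big1 ?addr0 ?mul1r // => k.
by rewrite -val_eqE /= => /negbTE->.
Qed.

Lemma packed_or_move A : sign_restricted A ->
  packed A \/
  exists B, [/\ sign_restricted B, is_interchange A B, weight B < weight A,
    row_sums B = row_sums A & col_sums B = col_sums A].
Proof.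
move=> srA; have [col dom] := iffLR (sign_restrictedP A) srA.
pose movable (k : nat) := exists j j' : 'I_n, [/\ (j < j')%N, csum A k j = 0, csum A k j' = 1
  & dominated (fun l => csum A k l + move_left j j' l) (csum A k.+1)].
have dich k : (k < m)%N -> initial_part (csum A k) (csum A k.+1) \/ movable k.
  move=> km; apply: dominated_move (dom k km) => l; apply: col => //.
  exact: ltnW.
have search p : (p <= m)%N ->
    (forall k, (k < p)%N -> initial_part (csum A k) (csum A k.+1)) \/
    exists k, (k < m)%N /\ movable k.
  elim: p => [|p IH] pm; first by left.
  have [IHl|] := IH (ltnW pm); last by right.
  have [ip|mp] := dich p pm; last by right; exists p.
  by left=> k; rewrite ltnS leq_eqVlt => /orP[/eqP->//|/IHl].
have [|[k [km mov]]] := search m (leqnn m); first by left.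
(* Row 0 of [csum] is zero and has no element to move, so [k = i.+1], and rows [i] and [i.+1] of the
   matrix are interchanged. *)
right; case: k km mov => [|i] im [j [j' [jj' xj xj' domE]]].
  by move: xj'; rewrite csum0.
pose i0 : 'I_m := Ordinal (ltnW im); pose i1 : 'I_m := Ordinal im.
have cE k l : csum (A + interchange_mx i0 i1 j j') k l =
    csum A k l + (k == i.+1)%:R * move_left j j' l.
  exact: csum_interchange.
exists (A + interchange_mx i0 i1 j j'); split; last 2 first.
- exact: row_sums_interchange.
- exact: col_sums_interchange.
- apply/sign_restrictedP; split=> [k l km|k km l].
    rewrite cE; case: eqP => [->|_]; last by rewrite mul0r addr0 col.
    rewrite mul1r /move_left; case: (eqVneq l j) => [->|_].
      by rewrite xj -val_eqE /= ltn_eqF.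
    case: (eqVneq l j') => [->|_]; first by rewrite xj'.
    by rewrite subrr addr0 col // ltnW.
  have same r : r != i.+1 -> psum (csum (A + interchange_mx i0 i1 j j') r) l.+1 =
      psum (csum A r) l.+1.
    by move=> /negbTE ri; apply: eq_psum => c _; rewrite cE ri mul0r addr0.
  have moved : psum (csum (A + interchange_mx i0 i1 j j') i.+1) l.+1 =
      psum (fun c => csum A i.+1 c + move_left j j' c) l.+1.
    by apply: eq_psum => c _; rewrite cE eqxx mul1r.
  (* Two comparisons are affected: with the next row it holds by the choice of the move, with the
     previous row because a move to the left only raises prefix sums. *)
  case: (eqVneq k i.+1) km => [-> _|ki km].
    by rewrite moved same ?domE // gtn_eqF.
  rewrite same //; case: (eqVneq k i) km => [->|ki'] km; last by rewrite same ?eqSS ?dom.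
  rewrite moved psumD (le_trans (dom i km l)) // lerDl psum_move_left.
  by rewrite subr_ge0; case: ltnP => // j'l; rewrite (ltn_trans jj' j'l).
- apply/existsP; exists i0; apply/existsP; exists i1.
  apply/existsP; exists j; apply/existsP; exists j'.
  by rewrite /= ltnSn jj' eqxx.
- by rewrite weight_interchange // gtrDl subr_lt0 ltz_nat.
Qed.

Lemma linked_packed A : sign_restricted A ->
  exists C, [/\ srm_linked A C, sign_restricted C, packed C,
    row_sums C = row_sums A & col_sums C = col_sums A].
Proof.
have [w] := ubnP `|weight A|%N; elim: w A => // w IH A Aw srA.
have [pA|[B [srB AB lt rB cB]]] := packed_or_move srA.
  by exists A; split=> //; apply: srm_linked_refl.
have [|//|C [BC srC pC rC cC]] := IH B.
  by have := weight_ge0 srA; have := weight_ge0 srB; lia.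
exists C; split; rewrite ?rC ?cC //.
by apply: srm_linked_trans BC; apply: srm_linked_step.
Qed.

End ColumnPartialSums.

(* A chain A^(1) = A, ..., A^(k) is the nonempty sequence A :: s, with
   k = (size s).+1 and A^(k) = last A s. *)
Theorem theorem3p1 (m n : nat) (R : 'rV[int]_m) (S : 'rV[int]_n)
    (A B : 'M[int]_(m, n))
    (srmA : sign_restricted A) (srmB : sign_restricted B)
    (rowA : row_sums A = R) (colA : col_sums A = S)
    (rowB : row_sums B = R) (colB : col_sums B = S) :
  (exists s : seq 'M[int]_(m, n),
     [/\ all (@sign_restricted m n) (A :: s),
         path (@is_interchange m n) A s
       & last A s \in zero_one_class R S]) /\
  (exists s : seq 'M[int]_(m, n),
     [/\ all (@sign_restricted m n) (A :: s),
         path (@is_interchange m n) A s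
       & last A s = B]).
Proof.
have [C [AC srC pC rC cC]] := linked_packed srmA.
have [D [BD srD pD rD cD]] := linked_packed srmB.
(* Both chains end at the same matrix, so the second, reversed, continues the first. *)
have DC : D = C by apply: packed_inj; rewrite // ?rC ?cC ?rD ?cD ?rowA ?colA.
split; last by apply: srm_linked_trans AC _; apply: srm_linked_sym; rewrite -DC.
have [s [srs ps lastC]] := AC; exists s; split=> //.
by rewrite lastC -rowA -colA -rC -cC; apply: packed_zero_one.
Qed.
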